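(* Let $P$ be a finite poset with $|P|\ge2$, connected Hasse diagram, and a maximum element $\hat1$. If $\phi$ is a Gorenstein labeling of $P$, then $\phi(x)=\mu_{\widehat P}(x)$ for all $x\ne\hat1$ and $\phi(\hat1)=\mu_{\widehat P}(\hat1)+1$. Consequently, $U_P$ is Gorenstein if and only if $\sum_{x\in A}\mu_{\widehat P}(x)=-1$ for all downsets $A$ of $P$ with $\dim(A)=1$.
   Context: $\widehat P$ is the poset obtained from $P$ by adjoining a new minimum element $\hat0$ (even if $P$ already has a minimum). Its one-variable Möbius function $\mu_{\widehat P}:\widehat P\to\mathbb{Z}$ is defined recursively by $\sum_{y\le x}\mu_{\widehat P}(y)=\delta_{\hat0,x}$ for all $x\in\widehat P$. For $S\subseteq P$, $cc(S)$ is the number of connected components of the subgraph of the undirected Hasse diagram of $P$ induced on $S$ ($cc(\varnothing)=0$); for an upset or downset $A$, $\dim(A)=cc(A)+cc(P\setminus A)-1$. A Gorenstein labeling is $\phi:P\to\mathbb{Z}$ with $\sum_{z\in P}\phi(z)=0$ and $\sum_{z\in A}\phi(z)=1$ for every upset $A$ with $\dim(A)=1$. $U_P$ is the affine toric variety of the braid cone $\sigma_P=\{x\in\mathbb{R}^n/\mathbb{R}(1,\dots,1): x_i\le x_j \text{ whenever } i<_Pj\}$ (with $P$ identified with $[n]$) over the lattice $\mathbb{Z}^n/\mathbb{Z}(1,\dots,1)$; it is Gorenstein if some dual lattice vector pairs to $1$ with every ray generator of $\sigma_P$ (equivalently, $P$ has a Gorenstein labeling). *)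

(* Defs.v *)
From HB Require Import structures.
From mathcomp Require Import all_boot all_order all_algebra.
From mathcomp Require Import classical_sets reals.

Set Implicit Arguments.
Unset Strict Implicit.
Unset Printing Implicit Defensive.

Import Order.TTheory GRing.Theory Num.Theory.
Local Open Scope ring_scope.

Definition is_upset d (T : finPOrderType d) (A : {set T}) : Prop :=
  forall x y, x \in A -> (x <= y)%O -> y \in A.

Definition is_downset d (T : finPOrderType d) (A : {set T}) : Prop :=
  forall x y, y \in A -> (x <= y)%O -> x \in A.

Definition covers d (T : finPOrderType d) (x y : T) : bool :=
  (x < y)%O && ~~ [exists z, (x < z)%O && (z < y)%O].

Definition hasse d (T : finPOrderType d) : rel T :=
  fun x y => covers x y || covers y x.

Definition hasse_in d (T : finPOrderType d) (S : {set T}) : rel T :=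
  fun x y => [&& x \in S, y \in S & hasse x y].

(* [n_comp] counts components only for a symmetric relation and a closed set;
   both conditions are established just below. *)
Definition cc d (T : finPOrderType d) (S : {set T}) : nat :=
  n_comp (hasse_in S) S.

Lemma hasse_in_connect_sym d (T : finPOrderType d) (S : {set T}) :
  connect_sym (hasse_in S).
Proof.
apply: sym_connect_sym => x y.
by rewrite /hasse_in /hasse andbCA (orbC (covers x y)).
Qed.

Lemma hasse_in_closed d (T : finPOrderType d) (S : {set T}) :
  closed (hasse_in S) S.
Proof. by move=> x y /and3P[xS yS _]; rewrite xS yS. Qed.

Definition hasse_connected d (T : finPOrderType d) : Prop :=
  cc [set: T] = 1%N.

Definition ccdim d (T : finPOrderType d) (A : {set T}) : int :=
  (cc A)%:Z + (cc (~: A))%:Z - 1.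

Definition gorenstein_labeling d (T : finPOrderType d) (phi : T -> int) : Prop :=
  \sum_(z : T) phi z = 0 /\
  forall A : {set T}, is_upset A -> ccdim A = 1 -> \sum_(z in A) phi z = 1.

(* [None] is the adjoined minimum. *)
Definition hat (T : Type) : Type := option T.

Section Hat.
Context {d : Order.disp_t} {T : finPOrderType d}.

HB.instance Definition _ := Finite.on (hat T).

Definition hat_le (u v : hat T) : bool :=
  match u, v with
  | None, _ => true
  | Some _, None => false
  | Some x, Some y => (x <= y)%O
  end.

Fact hat_le_refl : reflexive hat_le.
Proof. by case=> //= x. Qed.

Fact hat_le_anti : antisymmetric hat_le.
Proof. by case=> [x|] [y|] //= /le_anti ->. Qed.

Fact hat_le_trans : transitive hat_le.
Proof. by case=> [y|] [x|] [z|] //=; apply: le_trans. Qed.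

HB.instance Definition _ := Order.Le_isPOrder.Build d (hat T)
  hat_le_refl hat_le_anti hat_le_trans.

Fact hat_le0x (u : hat T) : ((None : hat T) <= u)%O.
Proof. by []. Qed.

HB.instance Definition _ := Order.hasBottom.Build d (hat T) hat_le0x.
End Hat.

(* The argument [n] bounds the recursion depth; [#|T|] always suffices, since
   every chain has at most that many elements. *)
Fixpoint mobius_rec d (T : finBPOrderType d) (n : nat) (x : T) : int :=
  if n is n'.+1 then
    (x == \bot%O)%:R - \sum_(y : T | (y < x)%O) mobius_rec n' y
  else 0.

Definition mobius d (T : finBPOrderType d) (x : T) : int := mobius_rec #|T| x.

Lemma mobius_rec_stable d (T : finBPOrderType d) (m n : nat) (x : T) :
  (#|[pred y : T | (y <= x)%O]| <= m)%N -> (#|[pred y : T | (y <= x)%O]| <= n)%N ->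
  mobius_rec m x = mobius_rec n x.
Proof.
have gt0 (z : T) : (0 < #|[pred y : T | (y <= z)%O]|)%N.
  by apply/card_gt0P; exists z; rewrite inE.
elim: m n x => [|m IH] [|n] x; rewrite ?leqn0 //.
- by move=> /eqP h; have := gt0 x; rewrite h.
- by move=> _ /eqP h; have := gt0 x; rewrite h.
move=> hm hn /=; congr (_ - _); apply: eq_bigr => y yx.
have lt : (#|[pred z : T | (z <= y)%O]| < #|[pred z : T | (z <= x)%O]|)%N.
  apply: proper_card; apply/properP; split.
    by apply/fintype.subsetP => z; rewrite !inE => /le_trans; apply; apply: ltW.
  by exists x; rewrite inE ?lexx ?lt_geF.
by apply: IH; rewrite -ltnS; apply: leq_trans lt _.
Qed.

Lemma sum_mobius d (T : finBPOrderType d) (x : T) :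
  \sum_(y : T | (y <= x)%O) mobius y = (\bot%O == x)%:R.
Proof.
have step (n : nat) (z : T) : (#|[pred y : T | (y <= z)%O]| <= n)%N ->
    mobius z = mobius_rec n z.
  by move=> h; apply: mobius_rec_stable => //; apply: max_card.
rewrite (bigD1 x) //= (step #|T|.+1) /=; last first.
  by apply: leq_trans (max_card _) _.
rewrite (eq_sym x) -addrA [X in _ + X]addrC; apply/eqP.
rewrite -subr_eq0 addrAC subrr add0r subr_eq0; apply/eqP.
by apply: eq_bigl => y; rewrite lt_neqAle andbC.
Qed.

(* Elements of R^n/R(1,...,1) and Z^n/Z(1,...,1) are handled through
   representatives T -> K, equality in the quotient being [eq_mod_ones].  The
   dual space (lattice) is { m | \sum_i m i = 0 }, on which the standard
   pairing does not depend on the representative. *)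
Section Quotient.
Context {T : finType} {K : pzRingType}.
Implicit Types x y m : {ffun T -> K}.

Definition eq_mod_ones x y : Prop := exists c : K, forall i, x i = y i + c.

Definition is_dual m : Prop := \sum_i m i = 0.

Definition pairing m x : K := \sum_i m i * x i.

Lemma pairing_mod_ones m x y :
  is_dual m -> eq_mod_ones x y -> pairing m x = pairing m y.
Proof.
move=> m0 [c xy]; rewrite /pairing.
under eq_bigr do rewrite xy mulrDr.
by rewrite big_split /= -mulr_suml m0 mul0r addr0.
Qed.
End Quotient.

Section Cone.
Context {R : realType} {T : finType}.
Local Open Scope classical_set_scope.
Implicit Types C F : set {ffun T -> R}.

Definition of_lattice (v : {ffun T -> int}) : {ffun T -> R} :=
  [ffun i => (v i)%:~R].

Definition is_face C F : Prop :=
  exists m : {ffun T -> R},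
    [/\ is_dual m, forall x, C x -> 0 <= pairing m x &
        F = [set x | C x /\ pairing m x = 0]].

(* A one-dimensional face; for a strongly convex cone, such as the braid cone
   of a connected poset, this is a half-line. *)
Definition is_ray C F : Prop :=
  is_face C F /\
  exists2 u : {ffun T -> R}, ~ eq_mod_ones u 0 &
    F = [set x | exists2 c : R, 0 <= c & eq_mod_ones x [ffun i => c * u i]].

(* [u] generates the semigroup of lattice points of some ray. *)
Definition ray_generator C (u : {ffun T -> int}) : Prop :=
  exists2 F, is_ray C F &
    F (of_lattice u) /\
    forall v : {ffun T -> int}, F (of_lattice v) ->
      exists k : nat, eq_mod_ones v (u *+ k).

(* The affine toric variety of [C] is Gorenstein. *)
Definition toric_gorenstein C : Prop :=
  exists2 m : {ffun T -> int}, is_dual m &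
    forall u, ray_generator C u -> pairing m u = 1.
End Cone.

Definition braid_cone (R : realType) d (T : finPOrderType d) :
    set {ffun T -> R} :=
  [set x | forall i j : T, (i < j)%O -> x i <= x j]%classic.

Arguments braid_cone R {d} T.

(* Main.v *)
(** An upset containing the maximum is connected, so the upsets of dimension 1
    are the complements of the nonempty connected downsets avoiding the maximum.
    A Gorenstein labeling therefore sums to -1 on every such downset; on the
    principal ones this is the recursion defining the Moebius function.

    Modulo constants, the ray generators of the braid cone are the indicators
    1_A of the upsets A of dimension 1.  Each of them spans the face cut out by
    the sum of the functionals x_j - x_i over all i < j on the same side of A.
    Conversely, if w spans a ray, let D be a connected component of the set of
    points where w is not maximal, and A its complement: both 1_A and
    w - e * 1_A lie in the cone for small e > 0, hence 1_A lies on the ray. *)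
Require Import Defs.
From mathcomp Require Import all_boot all_order all_algebra.
From mathcomp Require Import classical_sets reals.

Local Open Scope ring_scope.

Set Implicit Arguments.
Unset Strict Implicit.
Unset Printing Implicit Defensive.

Import Order.TTheory GRing.Theory Num.Theory.

Lemma sum_setC (V : nmodType) (T : finType) (f : T -> V) (A : {set T}) :
  \sum_x f x = \sum_(x in A) f x + \sum_(x in ~: A) f x.
Proof.
rewrite (bigID (fun x => x \in A)) /=; congr (_ + _).
by apply: eq_bigl => x; rewrite inE.
Qed.

(** * Connectivity of induced Hasse diagrams *)

Section HasseComponents.
Variables (d : Order.disp_t) (P : finPOrderType d).
Implicit Types (A D S : {set P}) (x y z : P).

(** Induction on the size of the interval from [x] to [y]: if [y] does not cover [x], split at a
    point strictly between them. *)
Lemma connect_hasse_le S x y :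
    (forall z, (x <= z)%O -> (z <= y)%O -> z \in S) -> (x <= y)%O ->
  connect (hasse_in S) x y.
Proof.
have [n] := ubnP #|[pred z | (x <= z)%O && (z <= y)%O]|.
elim: n x y => // n IH x y; rewrite ltnS => card_xy xyS le_xy.
have [->|neq_xy] := eqVneq x y; first exact: connect0.
have lt_xy : (x < y)%O by rewrite lt_neqAle neq_xy.
have [cov|] := boolP (covers x y).
  by apply: connect1; rewrite /hasse_in /hasse cov !xyS.
rewrite /covers lt_xy negbK => /existsP[z /andP[lt_xz lt_zy]].
apply: (@connect_trans _ _ z); apply: IH.
- apply: leq_trans card_xy; apply: proper_card; apply/properP; split.
    apply/fintype.subsetP => t; rewrite !inE => /andP[-> tz] /=.
    exact: le_trans tz (ltW lt_zy).
  by exists y; rewrite !inE ?le_xy ?lexx //= lt_geF.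
- by move=> t xt tz; apply: xyS xt (le_trans tz (ltW lt_zy)).
- exact: ltW.
- apply: leq_trans card_xy; apply: proper_card; apply/properP; split.
    apply/fintype.subsetP => t; rewrite !inE => /andP[zt ->]; rewrite andbT.
    exact: le_trans (ltW lt_xz) zt.
  by exists x; rewrite !inE ?le_xy ?lexx //= lt_geF.
- by move=> t zt ty; apply: xyS (le_trans (ltW lt_xz) zt) ty.
- exact: ltW.
Qed.

Lemma connect_hasse_in S x y :
  connect (hasse_in S) x y -> (x \in S) = (y \in S).
Proof. exact/closed_connect/hasse_in_closed. Qed.

Lemma cc_eq1P S :
  cc S = 1%N <->
  exists2 x, x \in S & forall y, y \in S -> connect (hasse_in S) x y.
Proof.
have symS := hasse_in_connect_sym S; split.
  move=> /eqP/card1P[x xE].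
  have /[!inE] := xE x; rewrite eqxx => /andP[_ xS].
  have rootx y : y \in S -> fingraph.root (hasse_in S) y = x.
    move=> yS; apply/eqP; have := xE (fingraph.root (hasse_in S) y).
    rewrite !inE => <-.
    by rewrite roots_root //= -(connect_hasse_in (connect_root _ y)).
  by exists x => // y yS; apply/(fingraph.rootP symS); rewrite !rootx.
move=> [x xS xconn]; apply/eqP/card1P; exists (fingraph.root (hasse_in S) x) => y.
rewrite !inE; apply/andP/eqP => [[/eqP yE yS]|->].
  by rewrite -yE; apply/esym/(fingraph.rootP symS)/xconn.
by rewrite -(connect_hasse_in (connect_root _ x)); split=> //; apply: roots_root.
Qed.

Lemma cc0 : cc (finset.set0 : {set P}) = 0%N.
Proof. by apply: eq_card0 => x; rewrite !inE andbF. Qed.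

Lemma cc_upset A top : (forall x, (x <= top)%O) -> is_upset A -> top \in A ->
  cc (A : {set P}) = 1%N.
Proof.
move=> top_max upA topA; apply/cc_eq1P; exists top => // x xA.
rewrite hasse_in_connect_sym; apply: connect_hasse_le => // z xz _.
exact: upA xA xz.
Qed.

Lemma cc_principal_downset x : cc [set y | (y <= x)%O] = 1%N.
Proof.
apply/cc_eq1P; exists x => [|y]; rewrite inE // => yx.
rewrite hasse_in_connect_sym; apply: connect_hasse_le => // z _.
by rewrite inE.
Qed.

(** A path in [S] from [x] never leaves the component of [x], so it is also a path in the subgraph
    induced on that component. *)
Lemma cc_component S x : x \in S -> cc [set y | connect (hasse_in S) x y] = 1%N.
Proof.
move=> xS; apply/cc_eq1P; exists x => [|y]; rewrite inE ?connect0 //.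
move=> /connectP[p]; elim/last_ind: p y => [|p z IH] y.
  by move=> _ ->; apply: connect0.
rewrite rcons_path last_rcons => /andP[xp ez] ->.
apply: connect_trans (IH _ xp erefl) _; apply: connect1.
have xl : connect (hasse_in S) x (last x p) by apply/connectP; exists p.
rewrite /hasse_in !inE xl (connect_trans xl (connect1 ez)) /=.
by case/and3P: ez.
Qed.

Lemma connect_hasse_const (X : Type) (f : P -> X) S x y :
    (forall i j, i \in S -> j \in S -> (i < j)%O -> f i = f j) ->
  connect (hasse_in S) x y -> f x = f y.
Proof.
move=> fS /connectP[p]; elim: p x => [|z p IH] x /=; first by move=> _ ->.
move=> /andP[/and3P[xS zS xz] zp] yE; rewrite -(IH z zp yE).
by case/orP: xz => /andP[lt_xz _]; [|symmetry]; apply: fS.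
Qed.

Lemma is_upsetC D : is_downset D -> is_upset (~: D).
Proof.
by move=> dnD x y; rewrite !inE => xD xy; apply: contra xD => /dnD; apply.
Qed.

Lemma is_downsetC A : is_upset A -> is_downset (~: A).
Proof.
by move=> upA x y; rewrite !inE => yA xy; apply: contra yA => /upA; apply.
Qed.

Lemma ccdimC A : ccdim (~: A) = ccdim A :> int.
Proof. by rewrite /ccdim finset.setCK addrC [_%:Z + _]addrC addrC. Qed.

Lemma ccdim_upset_eq1 A top : (forall x, (x <= top)%O) -> is_upset A ->
  ccdim A = 1 <-> top \in A /\ cc (~: A) = 1%N.
Proof.
move=> top_max upA; have [topA|topA] := boolP (top \in A).
  rewrite /ccdim (cc_upset top_max upA topA) addrAC subrr add0r.
  by split=> [[]|[_ ->]].
(* An upset avoiding [top] is empty, so its dimension is 0 + 1 - 1 = 0. *)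
have A0 : A = finset.set0.
  apply/finset.setP => x; rewrite inE; apply: contraNF topA => xA.
  exact: upA xA (top_max x).
have -> : ccdim A = 0.
  have upT : is_upset [set: P] by move=> x y _ _; rewrite finset.in_setT.
  by rewrite /ccdim A0 cc0 finset.setC0 (cc_upset top_max upT) ?finset.in_setT.
by split=> [//|[]].
Qed.

End HasseComponents.

(** * Gorenstein labelings and the Moebius function *)

Section MobiusHat.
Variables (d : Order.disp_t) (P : finPOrderType d).
Local Notation mu x := (mobius (Some x : hat P)).

Lemma sum_hat (Q : pred (hat P)) (F : hat P -> int) :
  Q None -> \sum_(u | Q u) F u = F None + \sum_(x : P | Q (Some x)) F (Some x).
Proof.
move=> Q0; rewrite (bigD1 None) //=; congr (_ + _).
rewrite (reindex_omap (Some : P -> hat P) id) => [|[x|]] //=; last first.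
  by move=> /andP[_ /eqP].
by apply: eq_bigl => x; rewrite eqxx !andbT.
Qed.

Lemma mobius_hat0 : mobius (None : hat P) = 1.
Proof.
have := sum_mobius (None : hat P); rewrite eqxx sum_hat ?lexx //.
by rewrite big_pred0 ?addr0.
Qed.

Lemma sum_mobius_hat (x : P) : \sum_(y : P | (y <= x)%O) mu y = -1.
Proof.
have := sum_mobius (Some x : hat P); rewrite sum_hat // mobius_hat0.
by move=> /eqP; rewrite addrC addr_eq0 => /eqP.
Qed.

Lemma gorenstein_mobius (top : P) (phi : P -> int) :
    (forall x, (x <= top)%O) -> gorenstein_labeling phi ->
  (forall x, x != top -> phi x = mu x) /\ phi top = mu top + 1.
Proof.
move=> top_max [phi0 phi1].
have sum_mu : \sum_x mu x = -1.
  by rewrite -(sum_mobius_hat top); apply: eq_bigl => x; rewrite top_max.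
have sum_phi x : x != top -> \sum_(y | (y <= x)%O) phi y = -1.
  move=> xtop; set D := [set y | (y <= x)%O].
  have dnD : is_downset D by move=> y z; rewrite !inE => zx /le_trans; apply.
  have : \sum_(z in ~: D) phi z = 1.
    apply: phi1 (is_upsetC dnD) _.
    apply/(ccdim_upset_eq1 top_max (is_upsetC dnD)); split.
      by rewrite !inE; apply: contra xtop => ?; rewrite eq_le top_max.
    by rewrite finset.setCK cc_principal_downset.
  move: phi0; rewrite (sum_setC phi D) => + sumC; rewrite sumC.
  move=> /eqP; rewrite addr_eq0 => /eqP <-.
  by apply: eq_bigl => y; rewrite inE.
have phi_mu x : x != top -> phi x = mu x.
  (* Strong induction on the size of the principal downset of [x]: [phi] and [mu] both sum to -1
     over it and agree strictly below [x]. *)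
  have [n] := ubnP #|[pred y | (y <= x)%O]|.
  elim: n x => // n IH x; rewrite ltnS => cardx xtop.
  have := sum_phi x xtop; rewrite -(sum_mobius_hat x).
  rewrite !(bigD1 (P := fun y => (y <= x)%O) x) //= => /eqP.
  rewrite -subr_eq -addrA -sumrB big1 ?addr0 => [/eqP //|y /andP[yx neq_yx]].
  rewrite IH ?subrr //; last first.
    by apply: contra xtop => /eqP ytop; rewrite eq_le top_max -ytop yx.
  apply: leq_trans cardx; apply: proper_card; apply/properP; split.
    by apply/fintype.subsetP => z; rewrite !inE => /le_trans; apply.
  by exists x; rewrite !inE ?lexx // lt_geF // lt_neqAle neq_yx.
(* At [top] the totals over [P] are compared instead: 0 for [phi], -1 for [mu]. *)
split=> //; move: phi0 sum_mu; rewrite !(bigD1 (P := xpredT) top) //=.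
rewrite (eq_bigr _ phi_mu); set s := \sum_(x | _) _ => phi_s mu_s.
by apply: (addIr s); rewrite phi_s addrAC mu_s addNr.
Qed.

End MobiusHat.

(** * Ray generators of the braid cone *)

Section BraidConeRays.
Variables (R : realType) (d : Order.disp_t) (P : finPOrderType d) (top : P).
Hypothesis top_max : forall x : P, (x <= top)%O.
Implicit Types (A D : {set P}) (x y z : P).
Local Notation C := (braid_cone R P).

Definition indicator (K : pzRingType) A : {ffun P -> K} :=
  [ffun x => (x \in A)%:R].

Lemma pairing_indicator (K : pzRingType) (m : {ffun P -> K}) A :
  pairing m (indicator K A) = \sum_(x in A) m x.
Proof.
rewrite /pairing [RHS]big_mkcond; apply: eq_bigr => x _ /=.
by rewrite ffunE; case: ifP; rewrite ?mulr1 ?mulr0.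
Qed.

Lemma of_lattice_indicator A : of_lattice (indicator int A) = indicator R A.
Proof. by apply/ffunP => x; rewrite !ffunE natz -pmulrn. Qed.

(** When [c] implies [<], this is a sum of the functionals defining the braid cone, hence cuts out a
    face of it. *)
Definition difference_sum (K : pzRingType) (c : rel P) : {ffun P -> K} :=
  [ffun z => \sum_(p : P * P | c p.1 p.2) ((p.2 == z)%:R - (p.1 == z)%:R)].

Lemma pairing_difference_sum (K : pzRingType) (c : rel P) (v : {ffun P -> K}) :
  pairing (difference_sum K c) v =
  \sum_(p : P * P | c p.1 p.2) (v p.2 - v p.1).
Proof.
have delta x : \sum_z (x == z)%:R * v z = v x.
  rewrite (bigD1 x) //= eqxx mul1r big1 ?addr0 // => z /negPf.
  by rewrite eq_sym => ->; rewrite mul0r.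
rewrite /pairing; under eq_bigr do rewrite ffunE mulr_suml.
rewrite exchange_big /=; apply: eq_bigr => p _.
by under eq_bigr do rewrite mulrBl; rewrite sumrB !delta.
Qed.

Lemma is_dual_difference_sum (K : pzRingType) (c : rel P) :
  is_dual (difference_sum K c).
Proof.
(* Being dual amounts to vanishing on the constant vector 1. *)
transitivity (pairing (difference_sum K c) [ffun => 1]).
  by rewrite /pairing; apply: eq_bigr => z _; rewrite (ffunE (fun=> 1)) mulr1.
by rewrite pairing_difference_sum big1 // => p _; rewrite !ffunE subrr.
Qed.

Lemma braid_cone_le (v : {ffun P -> R}) x y : C v -> (x <= y)%O -> v x <= v y.
Proof. by move=> Cv; rewrite le_eqVlt => /predU1P[->|/Cv]. Qed.

Lemma braid_cone_indicator A : is_upset A -> C (indicator R A).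
Proof.
move=> upA x y lt_xy; rewrite !ffunE ler_nat.
by case: (boolP (x \in A)) => // /upA -> //; apply: ltW.
Qed.

Lemma ray_generator_indicator A :
  is_upset A -> top \in A -> cc (~: A) = 1%N -> ray_generator C (indicator int A).
Proof.
move=> upA topA /cc_eq1P[x0]; rewrite inE => x0A x0conn.
have connA y : y \in A -> connect (hasse_in A) top y.
  move=> yA; rewrite hasse_in_connect_sym; apply: connect_hasse_le => // z yz _.
  exact: upA yA yz.
pose c : rel P := fun x y => (x < y)%O && ((x \in A) == (y \in A)).
pose u := indicator R A.
pose F := [set v | exists2 k : R, 0 <= k & eq_mod_ones v [ffun i => k * u i]]%classic.
(* A sum of nonnegative terms vanishes only termwise, so [v] agrees on comparable pairs within each
   side of [A]. Both sides are connected, hence [v] is determined by its values at [top] and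
   [x0]. *)
have CF v : C v -> pairing (difference_sum R c) v = 0 -> F v.
  move=> Cv; rewrite pairing_difference_sum => /eqP.
  rewrite psumr_eq0 => [/allP v0|[x y] /andP[/= lt_xy _]]; last first.
    by rewrite subr_ge0 Cv.
  have eqv x y : c x y -> v x = v y.
    move=> cxy; have /= := v0 (x, y) (mem_index_enum _).
    by rewrite cxy subr_eq0 => /eqP.
  exists (v top - v x0); first by rewrite subr_ge0 (braid_cone_le Cv).
  exists (v x0) => y; rewrite !ffunE; have [yA|yA] := boolP (y \in A).
    rewrite mulr1 subrK; symmetry; apply: connect_hasse_const (connA y yA).
    by move=> i j iA jA ij; apply: eqv; rewrite /c ij iA jA.
  rewrite mulr0 add0r; symmetry.
  apply: (@connect_hasse_const _ _ _ v (~: A)) (x0conn y _); last by rewrite inE.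
  move=> i j; rewrite !inE => /negPf iA /negPf jA ij.
  by apply: eqv; rewrite /c ij iA jA.
have FC v : F v -> C v /\ pairing (difference_sum R c) v = 0.
  move=> [k k0 [a va]]; split.
    move=> x y lt_xy; rewrite !va lerD2r !(ffunE (fun=> k * _)) ler_wpM2l //.
    exact: braid_cone_indicator lt_xy.
  rewrite pairing_difference_sum big1 // => -[x y] /= /andP[_ /eqP xyA].
  by rewrite !va !ffunE xyA subrr.
exists F.
  split.
    exists (difference_sum R c); split; first exact: is_dual_difference_sum.
      move=> v Cv; rewrite pairing_difference_sum sumr_ge0 // => -[x y].
      by move=> /andP[/= lt_xy _]; rewrite subr_ge0 Cv.
    by apply/seteqP; split=> [v /FC|v [Cv v0]]; [|apply: CF].
  exists u => // -[a ua].
  have := ua top; have := ua x0.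
  rewrite !ffunE topA (negPf x0A) !add0r => <- /eqP.
  by rewrite oner_eq0.
split.
  exists 1; first exact: ler01.
  exists 0 => x; rewrite of_lattice_indicator.
  by rewrite (ffunE (fun=> 1 * _)) mul1r addr0.
move=> v [k k0 [a va]].
have le_v : v x0 <= v top.
  have := va top; have := va x0; rewrite !ffunE topA (negPf x0A) mulr0 add0r.
  by rewrite mulr1 => <- vtop; rewrite -(ler_int R) vtop lerDr.
(* The multiple is the jump of [v] across [A]; by [le_v] the absolute value does not change it. *)
exists `|v top - v x0|%N, (v x0) => y.
rewrite ffunMnE ffunE.
have vk z : (v z)%:~R = k * (z \in A)%:R + (v x0)%:~R :> R.
  have := va z; have := va x0; rewrite !ffunE (negPf x0A) mulr0 add0r.
  by move=> ->.
apply/eqP; rewrite -subr_eq -(eqr_int R) intrB vk addrK.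
have [yA|yA] := boolP (y \in A); last by rewrite mulr0 mul0rn.
rewrite mulr1 -[1 *+ _]/(_%:R) natz gez0_abs ?subr_ge0 //.
by rewrite intrB (vk top) topA mulr1 addrK.
Qed.

Lemma ray_generatorP (u : {ffun P -> int}) : ray_generator C u ->
  exists A, [/\ is_upset A, top \in A, cc (~: A) = 1%N &
                 eq_mod_ones u (indicator int A)].
Proof.
move=> [F [[m [m0 mC FE]] [w wN FE']] [Fu gen]].
have FP v : F v <-> C v /\ pairing m v = 0 by rewrite FE.
have FP' v : F v <-> exists2 k : R, 0 <= k & eq_mod_ones v [ffun i => k * w i].
  by rewrite FE'.
have Fw : F w.
  apply/FP'; exists 1; first exact: ler01.
  by exists 0 => x; rewrite (ffunE (fun=> 1 * _)) mul1r addr0.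
have [Cw mw] := (FP w).1 Fw.
(* Otherwise [w] would be constant, that is, zero in the quotient. *)
have [x0 x0w] : exists x, w x < w top.
  case: (pickP [pred x | w x < w top]) => [x /= ?|none]; first by exists x.
  case: wN; exists (w top) => x; rewrite ffunE add0r; apply/eqP.
  by rewrite eq_le (braid_cone_le Cw (top_max x)) leNgt; have /= -> := none x.
pose D := [set x | w x < w top]; pose A := ~: [set x | connect (hasse_in D) x0 x].
have x0D : x0 \in D by rewrite inE.
have dnD : is_downset D.
  by move=> x y; rewrite !inE => yD /(braid_cone_le Cw)/le_lt_trans; apply.
have connD x y : (x <= y)%O -> y \in D -> connect (hasse_in D) x y.
  by move=> xy yD; apply: connect_hasse_le => // z _ zy; apply: dnD yD zy.
have AC : ~: A = [set x | connect (hasse_in D) x0 x] by rewrite finset.setCK.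
have wA x : x \notin A -> w x < w top.
  rewrite !inE negbK => /connect_hasse_in.
  by rewrite x0D inE.
(* The component of [x0] is closed downwards: a point below it stays in the downset [D] and is
   joined to it inside [D]. *)
have upA : is_upset A.
  rewrite /A; apply: is_upsetC => x y; rewrite !inE => x0y xy.
  apply: (connect_trans x0y); rewrite hasse_in_connect_sym; apply: connD => //.
  by rewrite -(connect_hasse_in x0y).
have topA : top \in A by apply: contraT => /wA; rewrite ltxx.
have x0A : x0 \notin A by rewrite !inE negbK connect0.
(* A point of [A] above the component cannot lie in [D], since it would then be joined to the
   component. *)
have step x y : x \notin A -> y \in A -> (x <= y)%O -> w top <= w y.
  rewrite !inE negbK => x0x x0y xy; rewrite leNgt; apply: contra x0y => wy.
  by apply: connect_trans x0x (connD _ _ xy _); rewrite inE.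
(* The gap [e] between [w top] and the largest value of [w] off [A] is the amount by which [w] can
   be lowered on [A] while staying monotone. *)
case: (arg_maxP (P := fun x => x \notin A) w x0A) => y0 y0A y0max.
pose e := w top - w y0; have e0 : 0 < e by rewrite subr_gt0 wA.
have we x : x \notin A -> w x + e <= w top.
  by move=> /y0max wx; rewrite /e addrCA gerDl subr_le0.
pose v : {ffun P -> R} := [ffun x => w x - e * indicator R A x].
have Cv : C v.
  move=> x y lt_xy; rewrite !ffunE; have wxy := Cw x y lt_xy.
  have [xA|xA] := boolP (x \in A).
    by rewrite (upA _ _ xA (ltW lt_xy)) lerD2r.
  have [yA|yA] := boolP (y \in A); last by rewrite !mulr0 !subr0.
  rewrite mulr0 mulr1 subr0 lerBrDr; apply: le_trans (we _ xA) _.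
  exact: step xA yA (ltW lt_xy).
have mv : pairing m v = - e * pairing m (indicator R A).
  rewrite -[RHS]add0r -mw /pairing mulr_sumr -big_split; apply: eq_bigr => x _ /=.
  by rewrite (ffunE (fun=> w _ - _)) mulrBr mulNr (mulrCA e).
(* Here [w = v + e * 1_A]. The functional [m] is nonnegative on both summands and zero on [w], so it
   vanishes on [1_A] because [e > 0]. *)
have FA : F (indicator R A).
  apply/FP; split; first exact: braid_cone_indicator.
  apply: le_anti; rewrite mC ?andbT; last exact: braid_cone_indicator.
  by have := mC v Cv; rewrite mv mulNr oppr_ge0 pmulr_rle0.
have [k [a uk]] := gen (indicator int A) (eq_ind_r F FA (of_lattice_indicator A)).
(* Subtracting the values at [x0] and [top] cancels the constant and exhibits 1 as [k] times an
   integer. *)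
have k1 : k = 1%N.
  have := uk top; have := uk x0; rewrite !ffunMnE !ffunE topA (negPf x0A).
  move=> ux0 utop; have : (u top - u x0) *+ k = 1.
    by rewrite mulrnBl -[LHS]addr0 -(subrr a) addrACA -opprD -utop -ux0 subr0.
  move=> /(congr1 absz); rewrite -mulr_natr abszM natz /= => /eqP.
  by rewrite muln_eq1 => /andP[_ /eqP].
exists A; split=> //; first by rewrite AC cc_component.
by exists (- a) => x; rewrite uk k1 addrK.
Qed.

End BraidConeRays.

(** * From ray generators to labelings and downset sums *)

Lemma toric_gorensteinP (R : realType) (d : Order.disp_t) (P : finPOrderType d)
    (top : P) (top_max : forall x : P, (x <= top)%O) :
  toric_gorenstein (braid_cone R P) <->
  exists phi : P -> int, gorenstein_labeling phi.
Proof.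
split=> [[m m0 mrays]|[phi [phi0 phi1]]].
  (* The dual vector is itself the labeling: its sum over [A] is its pairing with the ray generator
     [1_A]. *)
  exists m; split=> // A upA /(ccdim_upset_eq1 top_max upA)[topA ccA].
  by rewrite -pairing_indicator; apply/mrays/(ray_generator_indicator _ top_max).
have phi_dual : is_dual (finfun phi).
  by rewrite /is_dual; under eq_bigr do rewrite ffunE.
exists (finfun phi) => // u /(ray_generatorP top_max)[A [upA topA ccA uA]].
rewrite (pairing_mod_ones phi_dual uA) pairing_indicator.
under eq_bigr do rewrite ffunE.
by apply: phi1 => //; apply/(ccdim_upset_eq1 top_max).
Qed.

Theorem theorem5p5 (R : realType) (d : Order.disp_t) (P : finPOrderType d)
    (top : P) (card_P : (2 <= #|P|)%N) (conn_P : hasse_connected P)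
    (top_max : forall x : P, (x <= top)%O) :
  (forall phi : P -> int, gorenstein_labeling phi ->
     (forall x : P, x != top -> phi x = mobius (Some x : hat P)) /\
     phi top = mobius (Some top : hat P) + 1) /\
  (toric_gorenstein (braid_cone R P) <->
   forall A : {set P}, is_downset A -> ccdim A = 1 ->
     \sum_(x in A) mobius (Some x : hat P) = -1).
Proof.
(* The complement of such a downset is an upset of dimension 1, which contains [top]. *)
have top_notin D : is_downset D -> ccdim D = 1 -> top \notin D.
  move=> /is_upsetC upD; rewrite -ccdimC.
  by move=> /(ccdim_upset_eq1 top_max upD)[]; rewrite inE.
have top_neq (D : {set P}) x : top \notin D -> x \in D -> x != top.
  by move=> topD; apply: contraTneq => ->.
split=> [phi|]; first exact: gorenstein_mobius.
rewrite (toric_gorensteinP R top_max); split=> [[phi phiG] D dnD dimD|muD].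
  have [phi_mu _] := gorenstein_mobius top_max phiG.
  have topD := top_notin D dnD dimD.
  rewrite -(eq_bigr _ (fun x xD => phi_mu x (top_neq D x topD xD))).
  have [phi0 phi1] := phiG; move: phi0; rewrite (sum_setC phi D).
  rewrite (phi1 _ (is_upsetC dnD)) ?ccdimC // => /eqP.
  by rewrite addr_eq0 => /eqP.
(* The first half of the theorem leaves this as the only candidate. *)
pose phi x := mobius (Some x : hat P) + (x == top)%:R.
have phi0 : \sum_x phi x = 0.
  rewrite big_split /= (eq_bigl (fun x => (x <= top)%O)) ?sum_mobius_hat.
    by rewrite (bigD1 top) //= eqxx big1 ?addr0 // => x /negPf ->.
  by move=> x; rewrite top_max.
exists phi; split=> // A upA dimA.
have dnA := is_downsetC upA.
have dimC : ccdim (~: A) = 1 by rewrite ccdimC.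
(* Off [A] the correction at [top] is absent, so [phi] sums to -1 there and hence to 1 on [A]. *)
move: phi0; rewrite (sum_setC phi A).
rewrite [X in _ + X](eq_bigr (fun x => mobius (Some x : hat P))).
  by rewrite muD // => /eqP; rewrite subr_eq0 => /eqP.
move=> x /(top_neq _ _ (top_notin _ dnA dimC))/negPf xtop.
by rewrite /phi xtop addr0.
Qed.
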